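(* Let $K\subset S^3$ be the figure eight knot. The set of hyperbolic distances between (distinct) canonical horospheres in the complete hyperbolic structure on $S^3\setminus K$ is precisely the set $\{2\log|\alpha| \mid \alpha\in\mathbb{Z}[\omega]\setminus\{0\}\}$, where $\omega=-\frac12+\frac{\sqrt3}{2}i$.
   Context: Work in the upper half space model of hyperbolic 3-space $\mathbb{H}^3$. Let $\omega=-\frac12+\frac{\sqrt3}{2}i$, so $\mathbb{Z}[\omega]$ is the ring of Eisenstein integers. The complete hyperbolic structure on the figure eight knot complement (unique up to isometry) is $S^3\setminus K\cong\mathbb{H}^3/\Gamma$, where $$\Gamma=\langle A,B\rangle\subset \mathrm{SL}_2(\mathbb{Z}[\omega]),\qquad A=\begin{pmatrix}1&1\\0&1\end{pmatrix},\quad B=\begin{pmatrix}1&0\\-\omega&1\end{pmatrix},$$ acts on $\mathbb{H}^3$ through $\mathrm{PSL}_2(\mathbb{C})$ by isometries extending Möbius transformations of $\mathbb{C}\cup\{\infty\}$. A sufficiently small cusp neighbourhood of $S^3\setminus K$ lifts to an infinite family of disjoint horoballs in $\mathbb{H}^3$; expanding the cusp neighbourhood until these horoballs first become tangent gives the maximal cusp. The horospheres in $\mathbb{H}^3$ bounding the horoballs which are lifts of the maximal cusp are called the canonical horospheres of $S^3\setminus K$. Explicitly, they are the horospheres in the $\Gamma$-orbit of the horosphere centred at $\infty$ which is the horizontal Euclidean plane at height $1$. Any two distinct canonical horospheres are tangent or disjoint. The hyperbolic distance between two horospheres is the distance between them as subsets of $\mathbb{H}^3$, realised along the geodesic joining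 their centres (it is $0$ for tangent horospheres). *)

(* Defs.v *)
From HB Require Import structures.
From mathcomp Require Import all_boot all_order all_algebra.
From mathcomp Require Import all_classical all_reals exp.
From mathcomp Require Export complex.

Set Implicit Arguments.
Unset Strict Implicit.
Unset Printing Implicit Defensive.

Import Order.TTheory GRing.Theory Num.Theory.
Local Open Scope classical_set_scope.
Local Open Scope ring_scope.
Local Open Scope complex_scope.

Section FigureEight.
Variable R : realType.

(* The real-valued modulus; MathComp's `|z| takes its values in R[i]. *)
Definition modulus (z : R[i]) : R := ComplexField.Normc.normc z.

Definition omega : R[i] := (- 2^-1) +i* (Num.sqrt 3 / 2).

Definition eisenstein : set R[i] :=
  [set z | exists a b : int, z = a%:~R + b%:~R * omega].

(* A point (z, t) with 0 < t is the point of the upper half space with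
   horizontal coordinate z and height t. The sets of points considered below
   (horospheres and horoballs at positive height, and their images under
   invertible matrices) all lie in 0 < t. *)
Definition hpoint : Type := (R[i] * R)%type.

Definition arcosh (x : R) : R := ln (x + Num.sqrt (x ^+ 2 - 1)).

Definition hdist (p q : hpoint) : R :=
  arcosh (1 + (modulus (p.1 - q.1) ^+ 2 + (p.2 - q.2) ^+ 2)
              / (2 * p.2 * q.2)).

Definition hdist_set (S S' : set hpoint) : R :=
  inf [set hdist p q | p in S & q in S'].

Definition mat2 (a b c d : R[i]) : 'M[R[i]]_2 :=
  \matrix_(i < 2, j < 2)
    if i == 0 then (if j == 0 then a else b) else (if j == 0 then c else d).

(* The isometry extending the Moebius transformation z |-> (az + b)/(cz + d),
   for ad - bc = 1 (Poincare extension). *)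
Definition isom (g : 'M[R[i]]_2) (p : hpoint) : hpoint :=
  let a := g 0 0 in let b := g 0 1 in let c := g 1 0 in let d := g 1 1 in
  let z := p.1 in let t := p.2 in
  let D := modulus (c * z + d) ^+ 2 + modulus c ^+ 2 * t ^+ 2 in
  (((a * z + b) * (c * z + d)^* + a * c^* * (t ^+ 2)%:C) / D%:C, t / D).

Inductive generated (X : set 'M[R[i]]_2) : set 'M[R[i]]_2 :=
| generated_in g : X g -> generated X g
| generated_1 : generated X 1%:M
| generated_mul g h : generated X g -> generated X h -> generated X (g *m h)
| generated_inv g : generated X g -> generated X (invmx g).

Definition matA := mat2 1 1 0 1.
Definition matB := mat2 1 0 (- omega) 1.

(* The complement of the figure eight knot is the quotient of the upper half
   space by Gamma. *)
Definition Gamma : set 'M[R[i]]_2 := generated [set matA; matB].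

Definition horoball_infty (h : R) : set hpoint := [set p | h < p.2].
Definition horosphere_infty (h : R) : set hpoint := [set p | p.2 = h].

(* The open horoballs over a cusp neighbourhood: Gamma has a single class of
   parabolic fixed points, so they form the orbit of one horoball centred at
   infinity. *)
Definition cusp_lifts (h : R) : set (set hpoint) :=
  [set isom g @` horoball_infty h | g in Gamma].

Definition cusp_height (h : R) : Prop :=
  0 < h /\
  forall U V, cusp_lifts h U -> cusp_lifts h V -> U <> V -> U `&` V = set0.

(* Lowering h expands the cusp; since the horoballs are open, they stay
   disjoint up to and including the height where they first become tangent. *)
Definition maximal_cusp_height (h : R) : Prop :=
  cusp_height h /\ forall h', cusp_height h' -> h <= h'.

Definition canonical_horosphere (S : set hpoint) : Prop :=
  exists h g, [/\ maximal_cusp_height h, Gamma g &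
                  S = isom g @` horosphere_infty h].

End FigureEight.

(* Main.v *)
Require Import Defs.
From HB Require Import structures.
From mathcomp Require Import all_boot all_order all_algebra.
From mathcomp Require Import all_classical all_reals exp.
From mathcomp Require Import ring lra zify.

(** By invariance of the distance, the distance between two translates of the
    horosphere H at height 1 is that between H and gH for some g in Gamma. If
    c is the lower left entry of g and c <> 0, then gH is a sphere of Euclidean
    diameter 1 / |c|^2 tangent to the boundary plane, so the distance is 2 ln |c|
    ([hdist_set_infty]); if c = 0, then gH = H. Entries of Gamma are Eisenstein
    integers, whose nonzero elements have modulus at least 1. This gives one
    inclusion, and also shows that the translates of the horoball above height 1
    are disjoint; as B has an entry c of modulus 1, height 1 is where they first
    touch ([maximal_cusp_heightP]).

    For the other inclusion, every nonzero Eisenstein integer alpha must be, up to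
    a factor of modulus 1, the lower left entry of an element of Gamma
    ([Gamma_lower_left]). Conceptually this is because Gamma has one cusp and
    the same cusps as SL2(Z[w]). It suffices to know that every Eisenstein
    integer y is in the orbit of infinity ([Gamma_cusp_eisenstein]): if g sends
    infinity to y, with first column u (y, 1), then the lower left entry of B g is
    u (1 - w y), which is u alpha for a suitable y because w is a unit. The
    stabilizer of infinity contains the translations by 1 (meridian) and by
    2 + 4 w (longitude), whose lattice has index 4 in Z[w], so only four values of
    y have to be checked, and each is reached by a short word.

    The isometries are handled by identifying a point of upper half space with a
    Hermitian matrix of determinant 1 ([hform]), on which g acts by
    M |-> g M g^*. *)

Set Implicit Arguments.
Unset Strict Implicit.
Unset Printing Implicit Defensive.

Import Order.TTheory GRing.Theory Num.Theory.
Local Open Scope classical_set_scope.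
Local Open Scope ring_scope.

(** * Two by two matrices *)

Lemma ord2P (P : 'I_2 -> Prop) : P 0 -> P 1 -> forall k, P k.
Proof.
by move=> P0 P1 [[|[|//]] lt]; [move: P0|move: P1]; congr P; apply/val_inj.
Qed.

Lemma eq_mx22 (T : Type) (M N : 'M[T]_2) : M 0 0 = N 0 0 -> M 0 1 = N 0 1 ->
  M 1 0 = N 1 0 -> M 1 1 = N 1 1 -> M = N.
Proof.
by move=> e00 e01 e10 e11; apply/matrixP; apply: ord2P; apply: ord2P.
Qed.

Lemma mulmx22E (A : pzSemiRingType) (M N : 'M[A]_2) i j :
  (M *m N) i j = M i 0 * N 0 j + M i 1 * N 1 j.
Proof.
rewrite mxE !big_ord_recl big_ord0 addr0.
by have -> : lift ord0 ord0 = 1 :> 'I_2 by apply/val_inj.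
Qed.

Lemma det_mx22 (A : comNzRingType) (M : 'M[A]_2) :
  \det M = M 0 0 * M 1 1 - M 0 1 * M 1 0.
Proof.
rewrite (expand_det_row _ 0) !big_ord_recl big_ord0 /cofactor !det_mx11 !mxE /=.
have -> : lift 0 0 = 1 :> 'I_2 by apply/val_inj.
have -> : lift 1 0 = 0 :> 'I_2 by apply/val_inj.
by rewrite /= expr0 expr1; ring.
Qed.

Section CanonicalHorospheres.
Variable R : realType.
Local Notation "x %:C" := (x%:C)%C.
Local Notation "R [i]" := (R[i])%C.
Implicit Types (z : R[i]) (g : 'M[R[i]]_2) (p q : hpoint R) (h : R).
Local Notation w := (omega R).
Local Notation O := (@eisenstein R).

Lemma mat2E (a b c d : R[i]) : let M := mat2 a b c d in
  (M 0 0 = a) * (M 0 1 = b) * (M 1 0 = c) * (M 1 1 = d).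
Proof. by rewrite /= !mxE. Qed.

Lemma mat2_1 : 1%:M = mat2 1 0 0 1 :> 'M[R[i]]_2.
Proof. by apply: eq_mx22; rewrite mat2E mxE. Qed.

Lemma invmx_det1 g : \det g = 1 -> invmx g = mat2 (g 1 1) (- g 0 1) (- g 1 0) (g 0 0).
Proof.
move=> g1; have gU : g \in unitmx by rewrite unitmxE g1 unitr1.
apply: (can_inj (mulKmx gU)); rewrite mulmxV //.
move: g1; rewrite det_mx22 => g1.
by apply: eq_mx22; rewrite mulmx22E !mat2E mxE /= -?g1; ring.
Qed.

(** * The modulus *)

Lemma modulus_ge0 z : 0 <= modulus z.
Proof. by case: z => x y; exact: sqrtr_ge0. Qed.

Lemma modulusM z z' : modulus (z * z') = modulus z * modulus z'.
Proof. exact: ComplexField.Normc.normcM. Qed.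

Lemma modulusN z : modulus (- z) = modulus z.
Proof. exact: normcN. Qed.

Lemma modulus0 : modulus (0 : R[i]) = 0.
Proof. exact: ComplexField.Normc.normc0. Qed.

Lemma modulus1 : modulus (1 : R[i]) = 1.
Proof. exact: ComplexField.Normc.normc1. Qed.

Lemma sqr_modulus z : (modulus z ^+ 2)%:C = z * z^*.
Proof. by rewrite rmorphXn -normCK. Qed.

Lemma conj_embed (x : R) : (x%:C)^* = x%:C.
Proof. by apply/conj_Creal/complex_realP; exists x. Qed.

Lemma modulus_eq0 z : (modulus z == 0) = (z == 0).
Proof.
by apply/eqP/eqP => [/ComplexField.Normc.eq0_normc //|->]; exact: modulus0.
Qed.

(** * The action on upper half space *)

Definition denom g p : R :=
  modulus (g 1 0 * p.1 + g 1 1) ^+ 2 + modulus (g 1 0) ^+ 2 * p.2 ^+ 2.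

Lemma isom_height g p : (isom g p).2 = p.2 / denom g p.
Proof. by []. Qed.

Lemma denom_gt0 g p : \det g = 1 -> 0 < p.2 -> 0 < denom g p.
Proof.
move=> g1 p0; rewrite lt_def /denom addr_ge0 ?(sqr_ge0, mulr_ge0) // andbT.
apply/eqP => /eqP; rewrite paddr_eq0 ?(sqr_ge0, mulr_ge0) //.
rewrite expf_eq0 mulf_eq0 !expf_eq0 /= !modulus_eq0 (gt_eqF p0) orbF => /andP[d0 c0].
move: g1 d0; rewrite det_mx22 (eqP c0) mul0r add0r => g1 /eqP d0.
by move: g1 (oner_neq0 (R[i])); rewrite d0 !mulr0 subr0 => ->; rewrite eqxx.
Qed.

Lemma isom_height_gt0 g p : \det g = 1 -> 0 < p.2 -> 0 < (isom g p).2.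
Proof. by move=> g1 p0; rewrite isom_height divr_gt0 // denom_gt0. Qed.

(** The positive definite Hermitian matrix of determinant 1 with which hyperbolic
    space is identified with SL2(C) / SU2. In these coordinates the Poincare
    extension of g is M |-> g M g^*, which makes the action law and the invariance
    of the distance formal. *)
Definition hform p : 'M[R[i]]_2 :=
  let t := p.2%:C in
  mat2 ((p.1 * p.1^* + t ^+ 2) / t) (p.1 / t) (p.1^* / t) t^-1.

Definition adjoint g : 'M[R[i]]_2 := \matrix_(i, j) (g j i)^*.

Lemma hform_inj p q : p.2 != 0 -> q.2 != 0 ->
  hform p = hform q -> p = q.
Proof.
case: p q => [z t] [w s] /= t0 s0 /matrixP e.
have := e 1 1; rewrite !mat2E /= => /invr_inj /complexI ts.
have := e 0 1; rewrite !mat2E /= ts => /mulIf -> //.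
by rewrite invr_neq0 // fmorph_eq0.
Qed.

Lemma denom_embed g p : (denom g p)%:C =
  (g 1 0 * p.1 + g 1 1) * ((g 1 0)^* * p.1^* + (g 1 1)^*)
  + g 1 0 * (g 1 0)^* * p.2%:C ^+ 2.
Proof.
by rewrite rmorphD [X in _ + X]rmorphM /= !sqr_modulus rmorphXn rmorphD rmorphM.
Qed.

(** Only the top left entry is more than a division: it recovers |z'|^2 + t'^2, and
    there the unimodularity of g enters. *)
Lemma hform_isom g p : \det g = 1 -> 0 < p.2 ->
  hform (isom g p) = g *m hform p *m adjoint g.
Proof.
move=> g1 p0; have /lt0r_neq0 D0 := denom_gt0 g1 p0.
have zE : (isom g p).1 = ((g 0 0 * p.1 + g 0 1) * ((g 1 0)^* * p.1^* + (g 1 1)^*) +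
    g 0 0 * (g 1 0)^* * p.2%:C ^+ 2) / (denom g p)%:C.
  by rewrite /isom /= rmorphXn rmorphD rmorphM.
have tE : (isom g p).2%:C = p.2%:C / (denom g p)%:C by rewrite -fmorph_div.
have zE' : (isom g p).1^* = (((g 0 0)^* * p.1^* + (g 0 1)^*) * (g 1 0 * p.1 + g 1 1) +
    (g 0 0)^* * g 1 0 * p.2%:C ^+ 2) / (denom g p)%:C.
  rewrite zE fmorph_div /= conj_embed; congr (_ / _).
  by rewrite !(rmorphD, rmorphXn, rmorphM) /= !conjCK conj_embed.
have D0' : (denom g p)%:C != 0 by rewrite fmorph_eq0.
have t0 : p.2%:C != 0 by rewrite fmorph_eq0 lt0r_neq0.
move: g1; rewrite det_mx22 => g1.
have g1' : (g 0 0)^* * (g 1 1)^* - (g 0 1)^* * (g 1 0)^* = 1.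
  by rewrite -!rmorphM -rmorphB g1 rmorph1.
have DE := denom_embed g p.
rewrite /hform; move: (isom g p) zE zE' tE => p'.
move: (denom g p)%:C p.2%:C D0' t0 DE => D t D0' t0 DE zE zE' tE.
apply: eq_mx22; rewrite !mulmx22E !mat2E !mxE /= ?tE ?zE' ?zE.
- have e (n n' K : R[i]) : n * n' + t ^+ 2 = D * K ->
      (n / D * (n' / D) + (t / D) ^+ 2) / (t / D) = K / t.
    by move=> nK; rewrite -[K](mulKf D0') -nK; field; rewrite D0' t0.
  rewrite (e _ _ ((g 0 0 * p.1 + g 0 1) * ((g 0 0)^* * p.1^* + (g 0 1)^*) +
    g 0 0 * (g 0 0)^* * t ^+ 2)); first by field; rewrite t0.
  (* the two sides differ by t^2 (|det g|^2 - 1), so det g = 1 is used on each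
     of det g and its conjugate *)
  rewrite DE -[t ^+ 2 in X in _ + X = _]mulr1 -{1}g1.
  by rewrite -[t ^+ 2 * _ in LHS]mulr1 -g1'; ring.
- by field; rewrite D0' t0.
- by field; rewrite D0' t0.
- by rewrite -[t^-1]mul1r invf_div DE; field; rewrite t0.
Qed.

Lemma adjointM g g' : adjoint (g *m g') = adjoint g' *m adjoint g.
Proof.
apply/matrixP => i j; rewrite !mxE rmorph_sum; apply: eq_bigr => k _.
by rewrite !mxE rmorphM mulrC.
Qed.

Lemma det_adjoint g : \det (adjoint g) = (\det g)^*.
Proof. by rewrite !det_mx22 !mxE rmorphB !rmorphM /=; ring. Qed.

Lemma isomM g g' p : \det g = 1 -> \det g' = 1 -> 0 < p.2 ->
  isom (g *m g') p = isom g (isom g' p).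
Proof.
move=> g1 g'1 p0.
have gg'1 : \det (g *m g') = 1 by rewrite det_mulmx g1 g'1 mulr1.
have p'0 := isom_height_gt0 g'1 p0.
apply: hform_inj; rewrite ?lt0r_neq0 ?isom_height_gt0 //.
by rewrite !hform_isom // adjointM !mulmxA.
Qed.

Lemma isomE g p : isom g p =
  (((g 0 0 * p.1 + g 0 1) * (g 1 0 * p.1 + g 1 1)^*
    + g 0 0 * (g 1 0)^* * (p.2 ^+ 2)%:C) / (denom g p)%:C, p.2 / denom g p).
Proof. by []. Qed.

Lemma isom1 p : isom 1%:M p = p.
Proof.
case: p => z t; rewrite isomE /denom mat2_1 !mat2E modulus0 !mul0r add0r modulus1.
by rewrite !(expr1n, expr0n, mul0r, mul1r, mulr0, addr0, conjC0, conjC1, divr1, mulr1).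
Qed.

Lemma isomK g p : \det g = 1 -> 0 < p.2 -> isom (invmx g) (isom g p) = p.
Proof.
move=> g1 p0; have gU : g \in unitmx by rewrite unitmxE g1 unitr1.
by rewrite -isomM ?mulVmx ?isom1 // det_inv g1 invr1.
Qed.

Lemma isomVK g p : \det g = 1 -> 0 < p.2 -> isom g (isom (invmx g) p) = p.
Proof.
move=> g1 p0; have gU : g \in unitmx by rewrite unitmxE g1 unitr1.
by rewrite -isomM ?mulmxV ?isom1 // det_inv g1 invr1.
Qed.

(** cosh of the hyperbolic distance, minus 1. *)
Definition spread p q : R :=
  (modulus (p.1 - q.1) ^+ 2 + (p.2 - q.2) ^+ 2) / (2 * p.2 * q.2).

(** The determinants of the two summands are 1, so this says that the hyperbolic
    cosine is the polarization of the determinant, hence invariant under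
    M |-> g M g^*. *)
Lemma spread_hform p q : 0 < p.2 -> 0 < q.2 ->
  (spread p q)%:C = \det (hform p + hform q) / 2 - 2.
Proof.
case: p q => [z t] [w s] /= t0 s0.
have tC : t%:C != 0 by rewrite fmorph_eq0 lt0r_neq0.
have sC : s%:C != 0 by rewrite fmorph_eq0 lt0r_neq0.
rewrite det_mx22 ![(hform _ + _) _ _]mxE !mat2E /=.
rewrite /spread fmorph_div [X in X / _]rmorphD /= sqr_modulus.
rewrite !(rmorphXn, rmorphM, rmorphB) !rmorph_nat /=.
by field; rewrite tC sC.
Qed.

Lemma hdist_isom g p q : \det g = 1 -> 0 < p.2 -> 0 < q.2 ->
  hdist (isom g p) (isom g q) = hdist p q.
Proof.
move=> g1 p0 q0; congr (arcosh (1 + _)).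
rewrite -[LHS]/(spread _ _) -[RHS]/(spread _ _); apply: complexI.
rewrite !spread_hform ?isom_height_gt0 //.
rewrite !hform_isom // -mulmxDl -mulmxDr !det_mulmx det_adjoint g1.
by rewrite rmorph1 mul1r mulr1.
Qed.

(** * The distance from the horosphere at infinity to a translate *)

Lemma arcosh_le x y : 1 <= x -> x <= y -> arcosh x <= arcosh y :> R.
Proof.
move=> x1 xy; have y1 := le_trans x1 xy.
rewrite /arcosh ler_ln ?posrE ?ltr_pwDl ?sqrtr_ge0 ?(lt_le_trans ltr01) //.
by rewrite lerD // ler_wsqrtr // lerB // lerXn2r // nnegrE (le_trans ler01).
Qed.

Lemma arcosh_half_addV x : 1 <= x -> arcosh ((x + x^-1) / 2) = ln x :> R.
Proof.
move=> x1; have x0 : 0 < x := lt_le_trans ltr01 x1.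
have xN0 := lt0r_neq0 x0.
rewrite /arcosh.
have -> : ((x + x^-1) / 2) ^+ 2 - 1 = ((x - x^-1) / 2) ^+ 2 by field.
rewrite sqrtr_sqr ger0_norm; last first.
  by rewrite divr_ge0 // subr_ge0 (le_trans _ x1) // invf_le1.
by congr ln; field.
Qed.

Lemma ler_addV (x y : R) : 1 <= x -> x <= y -> x + x^-1 <= y + y^-1.
Proof.
move=> x1 xy; have x0 : 0 < x := lt_le_trans ltr01 x1.
have y0 : 0 < y := lt_le_trans x0 xy.
rewrite -subr_ge0.
have -> : y + y^-1 - (x + x^-1) = (y - x) * (y * x - 1) / (y * x).
  by field; rewrite !lt0r_neq0.
rewrite divr_ge0 ?mulr_ge0 ?subr_ge0 ?(ltW x0) ?(ltW y0) //.
by rewrite mulr_ege1 // (le_trans x1).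
Qed.

Lemma half_addV_ge1 (x : R) : 1 <= x -> 1 <= (x + x^-1) / 2.
Proof.
by move=> /(ler_addV (lexx 1)); rewrite invr1 ler_pdivlMr // mul1r.
Qed.

(** A point of the translate has height [1 / D] with [D >= |c|^2], so its distance
    to a point at height 1 is at least that of the vertical segment between the
    two heights, [ln D >= 2 ln |c|]. Equality holds over the pole [- d / c] of
    the Moebius map, whose vertical line is sent to the geodesic joining the
    two centres. *)
Lemma hdist_set_infty g : \det g = 1 -> 1 <= modulus (g 1 0) ->
  hdist_set (horosphere_infty 1) (isom g @` horosphere_infty 1) =
  2 * ln (modulus (g 1 0)).
Proof.
set c := modulus _ => g1 c1; have c0 : 0 < c := lt_le_trans ltr01 c1.
have cN0 : g 1 0 != 0 by rewrite -modulus_eq0 lt0r_neq0.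
have X1 : 1 <= c ^+ 2 by rewrite exprn_ege1.
have -> : 2 * ln c = arcosh ((c ^+ 2 + (c ^+ 2)^-1) / 2).
  by rewrite arcosh_half_addV // lnXn // mulr_natl.
rewrite /hdist_set; set E := image2 _ _ _; set m := arcosh _.
have lb : lbound E m.
  move=> _ [p p1 [_ [q q1 <-] <-]].
  have cD : c ^+ 2 <= denom g q by rewrite /denom q1 expr1n mulr1 lerDr sqr_ge0.
  rewrite /hdist isom_height p1 q1 mulr1 div1r.
  set D := denom g q in cD *.
  have D0 : 0 < D := lt_le_trans (lt_le_trans ltr01 X1) cD.
  apply: arcosh_le; first exact: half_addV_ge1.
  have -> : 1 + (modulus (p.1 - (isom g q).1) ^+ 2 + (1 - D^-1) ^+ 2) / (2 * D^-1)
      = modulus (p.1 - (isom g q).1) ^+ 2 * D / 2 + (D + D^-1) / 2.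
    by field; rewrite lt0r_neq0.
  rewrite -[leLHS]add0r lerD ?divr_ge0 ?(sqr_ge0, mulr_ge0) ?sqr_ge0 ?(ltW D0) //.
  by rewrite ler_pM2r ?invr_gt0 // ler_addV.
have attained : E m.
  have [q q1 qE] : exists2 q : hpoint R, q.2 = 1 & g 1 0 * q.1 + g 1 1 = 0.
    by exists (- g 1 1 / g 1 0, 1) => //=; rewrite mulrC divfK // addNr.
  have DE : denom g q = c ^+ 2.
    by rewrite /denom qE q1 modulus0 expr1n mulr1 expr0n add0r.
  exists ((isom g q).1, 1) => //; exists (isom g q); first by exists q.
  rewrite /hdist subrr modulus0 isom_height DE q1 /=; congr arcosh.
  by field; rewrite lt0r_neq0.
by apply/eqP; rewrite eq_le ge_inf ?lb_le_inf //; exists m.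
Qed.

Lemma hdist_set_isom g (S S' : set (hpoint R)) : \det g = 1 ->
  S `<=` [set p | 0 < p.2] -> S' `<=` [set p | 0 < p.2] ->
  hdist_set (isom g @` S) (isom g @` S') = hdist_set S S'.
Proof.
move=> g1 S0 S'0; congr inf; apply/seteqP; split => d /=.
  move=> [_ [p Sp <-] [_ [q Sq <-] <-]].
  by exists p => //; exists q => //; rewrite hdist_isom //; [exact: S0|exact: S'0].
move=> [p Sp [q Sq <-]]; exists (isom g p); first by exists p.
by exists (isom g q); [exists q|rewrite hdist_isom //; [exact: S0|exact: S'0]].
Qed.

(** * The ring of Eisenstein integers *)

Lemma omega2 : w * w = - 1 - w.
Proof.
have s3 : Num.sqrt 3 * Num.sqrt 3 = 3 :> R by rewrite -expr2 sqr_sqrtr.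
apply/eqP; rewrite eq_complex /=; apply/andP; split; apply/eqP; last by field.
have -> : Num.sqrt 3 / 2 * (Num.sqrt 3 / 2) = 3 / 4 :> R.
  by rewrite -[in RHS]s3; field.
by field.
Qed.

Lemma eisenstein0 : O 0.
Proof. by exists 0, 0; rewrite mul0r addr0. Qed.

Lemma eisenstein1 : O 1.
Proof. by exists 1, 0; rewrite mul0r addr0. Qed.

Lemma eisenstein_omega : O w.
Proof. by exists 0, 1; rewrite mul1r add0r. Qed.

Lemma eisensteinB x y : O x -> O y -> O (x - y).
Proof.
by move=> [a [b ->]] [c [d ->]]; exists (a - c), (b - d); rewrite !rmorphB; ring.
Qed.

Lemma eisensteinN x : O x -> O (- x).
Proof. by rewrite -sub0r; apply: eisensteinB; exact: eisenstein0. Qed.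

Lemma eisensteinD x y : O x -> O y -> O (x + y).
Proof. by move=> Ox Oy; rewrite -[y]opprK; apply/eisensteinB/eisensteinN. Qed.

Lemma eisensteinM x y : O x -> O y -> O (x * y).
Proof.
move=> [a [b ->]] [c [d ->]]; exists (a * c - b * d), (a * d + b * c - b * d).
have := omega2; rewrite !(rmorphB, rmorphD, rmorphM) /= => w2; ring: w2.
Qed.

Lemma modulus_eisenstein (a b : int) :
  modulus (a%:~R + b%:~R * w) ^+ 2 = (a * a - a * b + b * b)%:~R.
Proof.
have s3 : Num.sqrt 3 ^+ 2 = 3 :> R by rewrite sqr_sqrtr.
have -> : a%:~R + b%:~R * w
    = Complex (a%:~R - b%:~R / 2) (b%:~R * (Num.sqrt 3 / 2)) :> R[i].
  rewrite -[a%:~R](rmorph_int (real_complex R)) -[b%:~R](rmorph_int (real_complex R)).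
  by apply/eqP; rewrite eq_complex /=; apply/andP; split; apply/eqP; field.
rewrite /modulus /= sqr_sqrtr ?addr_ge0 ?sqr_ge0 //.
have -> : (b%:~R * (Num.sqrt 3 / 2)) ^+ 2 = b%:~R ^+ 2 * (3 / 4) :> R.
  by rewrite -[in RHS]s3; field.
by rewrite !(rmorphD, rmorphB, rmorphM) /=; field.
Qed.

(** The squared modulus is the integral norm form, so a nonzero value is at
    least 1. *)
Lemma modulus_eisenstein_ge1 x : O x -> x != 0 -> 1 <= modulus x.
Proof.
move=> [a [b ->]]; rewrite -modulus_eq0 => x0.
have {}x0 : 0 < modulus (a%:~R + b%:~R * w) by rewrite lt_def x0 modulus_ge0.
rewrite -[1](@expr1n R 2) -(ler_pXn2r (n := 2)) ?nnegrE ?modulus_ge0 ?expr1n //.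
have : 0 < modulus (a%:~R + b%:~R * w) ^+ 2 by rewrite exprn_gt0.
by rewrite modulus_eisenstein ltr0z ler1z.
Qed.

Lemma modulus_omega : modulus w = 1.
Proof.
apply/eqP; rewrite -(eqrXn2 (n := 2)) ?modulus_ge0 // expr1n.
have := modulus_eisenstein 0 1; rewrite mulr0z mulr1z add0r mul1r => ->.
by rewrite !mul0r subrr add0r mulr1.
Qed.

Lemma omega_neq0 : w != 0.
Proof. by rewrite -modulus_eq0 modulus_omega oner_neq0. Qed.

(** * First columns of elements of Gamma *)

Lemma Gamma_SL2_eisenstein g : Gamma g -> \det g = 1 /\ forall i j, O (g i j).
Proof.
have mat2O a b c d : O a -> O b -> O c -> O d -> forall i j, O (mat2 a b c d i j).
  by move=> Oa Ob Oc Od; apply: ord2P; apply: ord2P; rewrite mat2E.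
have O0 := eisenstein0; have O1 := eisenstein1.
elim=> {g} [g [->|->]||g g' _ [g1 gO] _ [g'1 g'O]|g _ [g1 gO]].
- by split; [rewrite det_mx22 !mat2E; ring|exact: mat2O].
- split; [by rewrite det_mx22 !mat2E; ring|apply: mat2O => //].
  exact/eisensteinN/eisenstein_omega.
- by rewrite det1 mat2_1; split=> //; exact: mat2O.
- rewrite det_mulmx g1 g'1 mulr1; split=> // i j; rewrite mulmx22E.
  by apply: eisensteinD; apply: eisensteinM.
- rewrite det_inv g1 invr1 invmx_det1 //; split=> //.
  by apply: mat2O => //; exact: eisensteinN.
Qed.

Lemma Gamma_det g : Gamma g -> \det g = 1.
Proof. by case/Gamma_SL2_eisenstein. Qed.

(** The orbit of infinity consists of the ratios x / y of such columns; working
    with columns lets a word in the generators be evaluated by successive row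
    operations. *)
Definition Gamma_column (x y : R[i]) :=
  exists g, [/\ Gamma g, g 0 0 = x & g 1 0 = y].

Lemma Gamma_column_mul g x y : Gamma g -> Gamma_column x y ->
  Gamma_column (g 0 0 * x + g 0 1 * y) (g 1 0 * x + g 1 1 * y).
Proof.
move=> Gg [h [Gh <- <-]]; exists (g *m h); split; last 2 first.
- by rewrite mulmx22E.
- by rewrite mulmx22E.
exact: generated_mul.
Qed.

Lemma Gamma_matA : Gamma (matA R).
Proof. by apply: generated_in; left. Qed.

Lemma Gamma_matB : Gamma (matB R).
Proof. by apply: generated_in; right. Qed.

Lemma Gamma_column1 : Gamma_column 1 0.
Proof. by exists 1%:M; split; [exact: generated_1|rewrite mxE..]. Qed.

Lemma Gamma_columnA x y : Gamma_column x y -> Gamma_column (x + y) y.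
Proof.
by move/(Gamma_column_mul Gamma_matA); rewrite !mat2E mul0r add0r !mul1r.
Qed.

Lemma Gamma_columnAV x y : Gamma_column x y -> Gamma_column (x - y) y.
Proof.
move/(Gamma_column_mul (generated_inv Gamma_matA)).
rewrite invmx_det1 ?(Gamma_det Gamma_matA) // !mat2E.
by rewrite oppr0 mul0r add0r mulN1r !mul1r.
Qed.

Lemma Gamma_columnB x y : Gamma_column x y -> Gamma_column x (y - w * x).
Proof.
move/(Gamma_column_mul Gamma_matB); rewrite !mat2E mul0r addr0 !mul1r.
by rewrite mulNr addrC.
Qed.

Lemma Gamma_columnBV x y : Gamma_column x y -> Gamma_column x (y + w * x).
Proof.
move/(Gamma_column_mul (generated_inv Gamma_matB)).
rewrite invmx_det1 ?(Gamma_det Gamma_matB) // !mat2E.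
by rewrite oppr0 opprK mul0r addr0 !mul1r addrC.
Qed.

(** The cusp group at infinity is generated by the meridian A and the longitude,
    the translation by 2 + 4 w = 2 i sqrt 3. The inverse translation is
    represented, up to sign, by the word B^-1 A B A^-2 B A B^-1, applied here
    letter by letter from the right; the inverse word gives the translation
    itself. *)
Lemma Gamma_column_longitude x y : Gamma_column x y ->
  Gamma_column (- (x - (2 + 4 * w) * y)) (- y).
Proof.
move/Gamma_columnBV/Gamma_columnA/Gamma_columnB/Gamma_columnAV/Gamma_columnAV.
move/Gamma_columnB/Gamma_columnA/Gamma_columnBV.
congr Gamma_column; ring: omega2.
Qed.

Lemma Gamma_column_longitudeV x y : Gamma_column x y ->
  Gamma_column (- (x + (2 + 4 * w) * y)) (- y).
Proof.
move/Gamma_columnB/Gamma_columnAV/Gamma_columnBV/Gamma_columnA/Gamma_columnA.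
move/Gamma_columnBV/Gamma_columnAV/Gamma_columnB.
congr Gamma_column; ring: omega2.
Qed.

(** * Eisenstein integers are equivalent to infinity *)

(** y is equivalent to infinity, with a column normalized up to a factor of modulus 1
    (in fact a unit of the ring), which does not affect horoball sizes. *)
Definition Gamma_cusp (y : R[i]) : Prop :=
  exists2 u : R[i], modulus u = 1 & Gamma_column (u * y) u.

Lemma Gamma_cusp_translate (t : R[i]) :
    (forall y, Gamma_cusp y -> Gamma_cusp (y + t)) ->
    (forall y, Gamma_cusp y -> Gamma_cusp (y - t)) ->
  forall (n : int) y, Gamma_cusp y -> Gamma_cusp (y + n%:~R * t).
Proof.
move=> up down n y cy; elim/int_ind: n => [|n IH|n IH].
- by rewrite mul0r addr0.
- have -> : y + n.+1%:~R * t = y + n%:~R * t + t by rewrite -addn1 PoszD rmorphD /=; ring.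
  exact: up.
- have -> : y + (- n.+1%:Z)%:~R * t = y + (- n%:Z)%:~R * t - t.
    by rewrite -addn1 PoszD opprD rmorphD /=; ring.
  exact: down.
Qed.

Lemma Gamma_cusp_int (n : int) y : Gamma_cusp y -> Gamma_cusp (y + n%:~R).
Proof.
rewrite -[n%:~R]mulr1; apply: Gamma_cusp_translate => {}y [u u1 uy]; exists u => //.
  by rewrite mulrDr mulr1; exact: Gamma_columnA.
by rewrite mulrBr mulr1; exact: Gamma_columnAV.
Qed.

Lemma Gamma_cusp_longitude (n : int) y :
  Gamma_cusp y -> Gamma_cusp (y + n%:~R * (2 + 4 * w)).
Proof.
apply: Gamma_cusp_translate => {}y [u u1 uy]; exists (- u); rewrite ?modulusN //.
  have -> : - u * (y + (2 + 4 * w)) = - (u * y + (2 + 4 * w) * u) by ring.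
  exact: Gamma_column_longitudeV.
have -> : - u * (y - (2 + 4 * w)) = - (u * y - (2 + 4 * w) * u) by ring.
exact: Gamma_column_longitude.
Qed.

Lemma modulus_1omega : modulus (1 + w) = 1.
Proof.
have -> : 1 + w = - (w * w) by rewrite omega2; ring.
by rewrite modulusN modulusM modulus_omega mulr1.
Qed.

(** Modulo 1 and 2 + 4 w, an Eisenstein integer a + b w is determined by b mod 4; these
    four have b congruent to 0, 1, 2 and 3. Each is reached from
    infinity by a word of length at most 3. *)
Lemma Gamma_cusp_representatives : [/\ Gamma_cusp (- 1), Gamma_cusp (1 + w),
  Gamma_cusp (1 + 2 * w) & Gamma_cusp (- 1 - w)].
Proof.
have col1 := Gamma_column1; have w2 := omega2.
split.
- exists (- (1 + w)); first by rewrite modulusN modulus_1omega.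
  move/Gamma_columnB/Gamma_columnAV/Gamma_columnBV: col1.
  by congr Gamma_column; ring: w2.
- exists (- w); first by rewrite modulusN modulus_omega.
  by move/Gamma_columnB: col1; congr Gamma_column; ring: w2.
- exists (- (1 + w)); first by rewrite modulusN modulus_1omega.
  move/Gamma_columnBV/Gamma_columnAV/Gamma_columnB: col1.
  by congr Gamma_column; ring: w2.
- exists w; first by rewrite modulus_omega.
  by move/Gamma_columnBV: col1; congr Gamma_column; ring: w2.
Qed.

Lemma Gamma_cusp_eisenstein y : O y -> Gamma_cusp y.
Proof.
have [c0 c1 c2 c3] := Gamma_cusp_representatives.
have shift y0 m n : Gamma_cusp y0 -> Gamma_cusp (y0 + m%:~R + n%:~R * (2 + 4 * w)).
  by move=> cy0; apply/Gamma_cusp_longitude/Gamma_cusp_int.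
move=> [a [b ->]].
have [n [[|[|[|[|//]]]] // _ bE]] :
    exists n, exists2 r : nat, (r < 4)%N & b = n * 4 + r%:Z.
  by exists (b %/ 4)%Z, `|(b %% 4)%Z|%N; lia.
(* n longitudes shift the real part by 2 n; the remaining integers correct it,
   the last representative having w-coordinate - 1 = 3 - 4 *)
- move: (shift _ (a + 1 - 2 * n) n c0); congr Gamma_cusp.
  by rewrite bE /= !(rmorphD, rmorphB, rmorphM) /=; ring.
- move: (shift _ (a - 1 - 2 * n) n c1); congr Gamma_cusp.
  by rewrite bE /= !(rmorphD, rmorphB, rmorphM) /=; ring.
- move: (shift _ (a - 1 - 2 * n) n c2); congr Gamma_cusp.
  by rewrite bE /= !(rmorphD, rmorphB, rmorphM) /=; ring.
- move: (shift _ (a - 1 - 2 * n) (n + 1) c3); congr Gamma_cusp.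
  by rewrite bE /= !(rmorphD, rmorphB, rmorphM) /=; ring.
Qed.

(** One cusp suffices: if a first column is u (y, 1), multiplying by B on the left
    turns its lower entry into u (1 - w y), and since w is a unit y can be chosen
    to make this u alpha. *)
Lemma Gamma_lower_left alpha : O alpha ->
  exists2 g, Gamma g & modulus (g 1 0) = modulus alpha.
Proof.
move=> Oa.
have : O ((1 - alpha) * (- 1 - w)).
  apply: eisensteinM; apply: eisensteinB.
  - exact: eisenstein1.
  - by [].
  - exact/eisensteinN/eisenstein1.
  - exact: eisenstein_omega.
move=> /Gamma_cusp_eisenstein[u u1 /Gamma_columnB[g [Gg _ g10]]].
exists g => //; rewrite g10.
have -> : u - w * (u * ((1 - alpha) * (- 1 - w))) = u * alpha.
  by ring: omega2.
by rewrite modulusM u1 mul1r.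
Qed.

(** * The maximal cusp *)

Lemma isom_image_mul g g' (S : set (hpoint R)) : \det g = 1 -> \det g' = 1 ->
  S `<=` [set p | 0 < p.2] ->
  isom (g *m g') @` S = isom g @` (isom g' @` S).
Proof.
move=> g1 g'1 S0; rewrite image_comp; apply: eq_imagel => p Sp /=.
by rewrite isomM //; exact: S0.
Qed.

Lemma isom_image1 (S : set (hpoint R)) : isom 1%:M @` S = S.
Proof.
by rewrite -[RHS]image_id; apply: eq_imagel => p _; rewrite isom1.
Qed.

Lemma isom_image_div g g' (S : set (hpoint R)) : \det g = 1 -> \det g' = 1 ->
  S `<=` [set p | 0 < p.2] ->
  isom g' @` S = isom g @` (isom (invmx g *m g') @` S).
Proof.
move=> g1 g'1 S0; have gU : g \in unitmx by rewrite unitmxE g1 unitr1.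
by rewrite -isom_image_mul ?mulKVmx // det_mulmx det_inv g1 g'1 invr1 mulr1.
Qed.

Lemma Gamma_div g g' : Gamma g -> Gamma g' -> Gamma (invmx g *m g').
Proof. by move=> Gg Gg'; exact/generated_mul/Gg'/generated_inv. Qed.

(** The diagonal entries are then inverse Eisenstein integers, hence of modulus 1: an
    element fixing infinity acts by a Euclidean isometry on horizontal planes. *)
Lemma Gamma_fix_infty_height g p : Gamma g -> g 1 0 = 0 -> (isom g p).2 = p.2.
Proof.
move=> /Gamma_SL2_eisenstein[+ gO] c0; rewrite det_mx22 c0 mulr0 subr0 => ad1.
have ge1 i : g i i != 0 -> 1 <= modulus (g i i) by apply: modulus_eisenstein_ge1.
have [/ge1 a1 /ge1 d1] : g 0 0 != 0 /\ g 1 1 != 0.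
  by apply/andP; rewrite -negb_or -mulf_eq0 ad1 oner_neq0.
have /eqP : modulus (g 0 0) * modulus (g 1 1) = 1 by rewrite -modulusM ad1 modulus1.
move=> ad; have d_eq1 : modulus (g 1 1) = 1.
  apply/eqP; rewrite eq_le d1 andbT -(eqP ad) ler_peMl //.
  exact: modulus_ge0.
rewrite isom_height /denom c0 mul0r add0r d_eq1 modulus0.
by rewrite expr1n expr0n mul0r addr0 divr1.
Qed.

Lemma Gamma_fix_infty_image g (P : R -> Prop) : Gamma g -> g 1 0 = 0 ->
  (forall t, P t -> 0 < t) ->
  isom g @` [set p | P p.2] = [set p | P p.2].
Proof.
move=> Gg c0 P0; have g1 := Gamma_det Gg.
apply/seteqP; split => [_ [p Pp <-]|p Pp].
  by rewrite /mkset Gamma_fix_infty_height.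
exists (isom (invmx g) p); last by rewrite isomVK //; exact: P0.
rewrite /mkset Gamma_fix_infty_height //; first exact: generated_inv.
by rewrite invmx_det1 // mat2E c0 oppr0.
Qed.

Lemma horoball_gt0 h : 0 <= h -> @horoball_infty R h `<=` [set p | 0 < p.2].
Proof. by move=> h0 p; exact: le_lt_trans. Qed.

Lemma horosphere_gt0 h : 0 < h -> @horosphere_infty R h `<=` [set p | 0 < p.2].
Proof. by move=> h0 p /= ->. Qed.

(** An overlap gives k in Gamma sending a point of height > 1 to one of height > 1. If
    the lower left entry c of k is nonzero then |c| >= 1, and k sends height t to
    height at most 1 / (|c|^2 t) < 1; so c = 0 and the horoballs coincide. *)
Lemma cusp_height1 : cusp_height (1 : R).
Proof.
split=> // _ _ [g Gg <-] [g' Gg' <-]; apply: contra_notP => /eqP/set0P.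
move=> [_ [[p p1 <-] [q q1]]] pq.
have g1 := Gamma_det Gg; have g'1 := Gamma_det Gg'.
have p0 : 0 < p.2 := lt_trans ltr01 p1.
have q0 : 0 < q.2 := lt_trans ltr01 q1.
have Gk := Gamma_div Gg Gg'; set k := _ *m _ in Gk.
have kq : isom k q = p.
  by rewrite isomM ?det_inv ?g1 ?invr1 // pq isomK.
rewrite (isom_image_div g1 g'1 (horoball_gt0 ler01)) -/k.
have [c0|cN0] := eqVneq (k 1 0) 0.
  rewrite (Gamma_fix_infty_image (P := fun t => 1 < t) Gk) // => t.
  exact: lt_trans.
have [k1 kO] := Gamma_SL2_eisenstein Gk.
have c1 := modulus_eisenstein_ge1 (kO 1 0) cN0.
have D0 := denom_gt0 k1 q0.
move: p1; rewrite /= /horoball_infty /= -kq isom_height ltr_pdivlMr // mul1r.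
rewrite ltNge => /negP[]; rewrite /denom.
have q2 : q.2 <= q.2 ^+ 2 by rewrite expr2 ler_peMl // ltW.
apply: (le_trans q2); rewrite -[leLHS]add0r lerD ?sqr_ge0 //.
by rewrite ler_peMl ?sqr_ge0 // exprn_ege1.
Qed.

(** B has lower left entry of modulus 1, so over its pole 1 / w it sends height t to
    height 1 / t. At t = 1 this exhibits a common point of the horoball at
    infinity and its image under B as soon as h < 1. *)
Lemma cusp_height_ge1 h : cusp_height h -> 1 <= h.
Proof.
move=> [h0 disj]; rewrite leNgt; apply/negP => h1.
have w0 := omega_neq0.
have D t : denom (matB R) (w^-1, t) = t ^+ 2.
  rewrite /denom !mat2E [(_, _).1]/= [(_, _).2]/= mulNr mulfV // addNr.
  by rewrite modulus0 modulusN modulus_omega expr0n expr1n mul1r add0r.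
have inV t : h < t -> (isom (matB R) @` horoball_infty h) (isom (matB R) (w^-1, t)).
  by move=> ht; exists (w^-1, t).
have height t : 0 < t -> (isom (matB R) (w^-1, t)).2 = t^-1.
  by move=> t0; rewrite isom_height D /=; field; rewrite lt0r_neq0.
have liftU : cusp_lifts h (horoball_infty h : set (hpoint R)).
  by exists 1%:M; [exact: generated_1|exact: isom_image1].
have liftV : cusp_lifts h (isom (matB R) @` horoball_infty h).
  by exists (matB R) => //; exact: Gamma_matB.
have UV : horoball_infty h <> isom (matB R) @` horoball_infty h.
  move=> UV; have : (isom (matB R) @` horoball_infty h) (isom (matB R) (w^-1, h^-1)).
    by apply: inV; rewrite (lt_trans h1) // invf_gt1.
  by rewrite -UV /horoball_infty /mkset height ?invr_gt0 // invrK ltxx.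
have /seteqP[+ _] := disj _ _ liftU liftV UV.
move=> /(_ (isom (matB R) (w^-1, 1)))[]; split; last exact: inV.
by rewrite /horoball_infty /mkset height // invr1.
Qed.

Lemma maximal_cusp_heightP h : maximal_cusp_height h <-> h = 1.
Proof.
split=> [[hh hmin]|->]; last by split; [exact: cusp_height1|exact: cusp_height_ge1].
by apply/le_anti; rewrite hmin ?cusp_height_ge1 //; exact: cusp_height1.
Qed.

Lemma canonical_horosphereP S : canonical_horosphere S <->
  exists2 g, Gamma g & S = isom g @` @horosphere_infty R 1.
Proof.
split=> [[h [g [/maximal_cusp_heightP-> Gg ->]]]|[g Gg ->]]; first by exists g.
by exists 1, g; split=> //; apply/maximal_cusp_heightP.
Qed.

(** Where c z + d = 1, the height 1 is sent to 1 / (1 + |c|^2). *)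
Lemma isom_horosphere_neq g : \det g = 1 -> g 1 0 != 0 ->
  isom g @` @horosphere_infty R 1 <> horosphere_infty 1.
Proof.
move=> g1 c0 e.
pose p : hpoint R := ((1 - g 1 1) / g 1 0, 1).
have pE : g 1 0 * p.1 + g 1 1 = 1 by rewrite /= mulrC divfK // subrK.
have : (isom g @` @horosphere_infty R 1) (isom g p) by exists p.
rewrite e /horosphere_infty /mkset isom_height => /eqP; apply/negP.
have D0 := denom_gt0 (p := p) g1 ltr01.
rewrite div1r invr_eq1 /denom pE modulus1 !expr1n mulr1 -subr_eq0 addrAC subrr.
by rewrite add0r expf_eq0 /= modulus_eq0.
Qed.

End CanonicalHorospheres.

Theorem theorem1p3 (R : realType) :
  [set d : R | exists S S' : set (hpoint R),
     [/\ canonical_horosphere S, canonical_horosphere S', S <> S' &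
         d = hdist_set S S']]
  = [set 2 * ln (modulus alpha) | alpha in @eisenstein R `\ 0].
Proof.
have H0 := @horosphere_gt0 R 1 ltr01.
apply/seteqP; split => [d [S [S' [/canonical_horosphereP[g Gg ->]]]]|].
  move=> /canonical_horosphereP[g' Gg' ->].
  have g1 := Gamma_det Gg; have g'1 := Gamma_det Gg'.
  rewrite (isom_image_div g1 g'1 H0); have Gk := Gamma_div Gg Gg'.
  set k := invmx g *m g' in Gk *.
  have [k1 kO] := Gamma_SL2_eisenstein Gk.
  move=> neq ->; have c0 : k 1 0 != 0.
    apply/eqP => c0; apply: neq.
    by rewrite (Gamma_fix_infty_image (P := fun t => t = 1) Gk) // => t ->.
  have kH0 : isom k @` horosphere_infty 1 `<=` [set p | 0 < p.2].
    by move=> _ [p /H0 p0 <-]; exact: isom_height_gt0.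
  exists (k 1 0); first by split=> //; apply/eqP.
  by rewrite hdist_set_isom // hdist_set_infty // modulus_eisenstein_ge1.
move=> _ [alpha [Oa /eqP a0] <-].
have [g Gg ga] := Gamma_lower_left Oa; have g1 := Gamma_det Gg.
have c0 : g 1 0 != 0 by rewrite -modulus_eq0 ga modulus_eq0.
exists (horosphere_infty 1), (isom g @` horosphere_infty 1); split.
- apply/canonical_horosphereP; exists 1%:M; first exact: generated_1.
  by rewrite isom_image1.
- by apply/canonical_horosphereP; exists g.
- exact/nesym/isom_horosphere_neq.
- by rewrite hdist_set_infty ?ga // modulus_eisenstein_ge1.
Qed.
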